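(* Let $G=(V,E)$ be a finite simple connected undirected graph with $V=\{1,2,\dots,n\}$, let $d$ be its distance function and, for $v\in V$, let $\mathcal{N}(v)$ be the set of vertices adjacent to $v$. Let $W\subseteq V$ and let $x=(x_1,\dots,x_n)$ be defined by $x_i=1$ if $i\in W$ and $x_i=0$ if $i\notin W$. Then $W$ is a minimal weakly convex dominating set of $G$ (that is, a weakly convex dominating set of smallest cardinality) if and only if $x$ is an optimal solution of the following integer linear program: minimize $\sum_{i=1}^n x_i$ subject to - $x_i+\sum_{j\in\mathcal{N}(i)}x_j\ge 1$ for all $1\le i\le n$; - $-x_i-x_j+\sum_{k\in\mathcal{N}(j),\ d(i,k)+d(k,j)=d(i,j)}x_k\ge -1$ for all $1\le i<j\le n$; - $x_i\in\{0,1\}$ for all $1\le i\le n$.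
   Context: Graphs are without loops and parallel edges. For vertices $u,v$ of a connected graph $G$, $d(u,v)$ denotes the length (number of edges) of a shortest $u$-$v$ path in $G$. $\mathcal{N}(v)$ is the open neighbourhood of $v$ (the set of all vertices adjacent to $v$, not containing $v$). A set $D\subseteq V$ is a dominating set of $G$ if every vertex $u\in V$ is in $D$ or has a neighbour in $D$. A set $W\subseteq V$ is weakly convex if for every two vertices $u,v\in W$ the distance between $u$ and $v$ in the subgraph of $G$ induced by $W$ equals $d(u,v)$; equivalently, for every two vertices $u,v\in W$ there exists at least one shortest $u$-$v$ path in $G$ all of whose vertices belong to $W$. A weakly convex dominating set is a set that is both weakly convex and dominating. A minimal weakly convex dominating set is a weakly convex dominating set of smallest cardinality among all weakly convex dominating sets of $G$. *)

(* Defs.v *)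
From mathcomp Require Import all_boot all_order all_algebra.

Set Implicit Arguments.
Unset Strict Implicit.
Unset Printing Implicit Defensive.

Import Order.TTheory GRing.Theory Num.Theory.

(* A simple graph on the vertex set T is given by its adjacency relation
   e : rel T, assumed symmetric and irreflexive where it is used. *)
Section Graphs.
Variables (T : finType) (e : rel T).

Definition neighbours (v : T) : {set T} := [set w | e v w].

Definition connected_graph := forall u v : T, connect e u v.

(* p lists the vertices after u, so the length of the path is size p. *)
Definition graph_path (u v : T) (p : seq T) : bool :=
  [&& path e u p, last u p == v & uniq (u :: p)].

(* All paths have length < #|T|; hence dist u v takes the junk value #|T|
   exactly when there is no u-v path. *)
Definition dist (u v : T) : nat :=
  find (fun k => [exists p : k.-tuple T, graph_path u v p]) (iota 0 #|T|).

End Graphs.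

Section WeaklyConvexDominatingSets.
Variables (T : finType) (e : rel T).
Implicit Types W D : {set T}.

Definition dominating D :=
  forall u : T, u \in D \/ exists2 v : T, v \in D & e u v.

Definition induced W : rel {x : T | x \in W} := fun u v => e (val u) (val v).

(* The connect conjunct says that the distance in the induced subgraph is
   finite; it cannot be dropped, as the junk value #|W| of dist on unconnected
   vertices might coincide with a genuine distance in the whole graph. *)
Definition weakly_convex W :=
  forall u v : {x : T | x \in W},
    connect (@induced W) u v /\
    dist (@induced W) u v = dist e (val u) (val v).

Definition weakly_convex_dominating W := weakly_convex W /\ dominating W.

Definition minimal_weakly_convex_dominating W :=
  weakly_convex_dominating W /\
  forall W', weakly_convex_dominating W' -> #|W| <= #|W'|.

End WeaklyConvexDominatingSets.

Section IntegerLinearProgram.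
Local Open Scope ring_scope.
Variables (n : nat) (e : rel 'I_n).
Implicit Types x y : 'rV[int]_n.

Definition objective x : int := \sum_(i < n) x 0 i.

Definition feasible x :=
  [/\ forall i : 'I_n,
        x 0 i + \sum_(j in neighbours e i) x 0 j >= 1,
      forall i j : 'I_n, (i < j)%N ->
        - x 0 i - x 0 j
          + \sum_(k in neighbours e j
                  | (dist e i k + dist e k j)%N == dist e i j) x 0 k >= -1
    & forall i : 'I_n, x 0 i = 0 \/ x 0 i = 1].

Definition optimal x :=
  feasible x /\ forall y, feasible y -> objective x <= objective y.

End IntegerLinearProgram.

(* Main.v *)
Require Import Defs.
From mathcomp Require Import all_boot all_order all_algebra.
From mathcomp Require Import zify.

Set Implicit Arguments.
Unset Strict Implicit.
Unset Printing Implicit Defensive.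

Import Order.TTheory GRing.Theory Num.Theory.
Local Open Scope ring_scope.

(** For a 0/1 vector, the second family of constraints says that for all i < j
    in W some neighbour k of j on a geodesic from i to j belongs to W. Such a k
    exists in a weakly convex set: it is the predecessor of j on a geodesic
    inside W. Conversely, k is closer to i than j is, so induction on
    the distance gives a geodesic inside W for every pair. As paths can be
    reversed, one orientation of each pair is enough, and this is why the
    program only has constraints for i < j. *)

Section Distance.
Local Open Scope nat_scope.
Variables (T : finType) (e : rel T).
Implicit Types (u v w : T) (p : seq T).

(** [p] may repeat vertices, while [dist] only searches simple paths. Shortening [p] yields a simple
    path with fewer than [#|T|] edges, whose length is in the searched range. *)
Lemma dist_le u v p : path e u p -> last u p = v -> dist e u v <= size p.
Proof.
move=> up <-; case: (shortenP up) => q uq uniq_q /uniq_leq_size le_qp.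
apply: leq_trans (le_qp _); last by case/andP: uniq_q.
have q_lt : size (u :: q) <= #|T| by rewrite -(card_uniqP uniq_q) max_card.
rewrite leqNgt; apply/negP => /(before_find 0).
rewrite nth_iota // add0n => /existsP; apply.
by exists (in_tuple q); rewrite /graph_path uq eqxx uniq_q.
Qed.

(** Connectedness makes the search in [dist] succeed, so its value is a genuine length and not the
    default [#|T|]. *)
Lemma geodesic_exists u v :
  connect e u v -> exists p, [/\ path e u p, last u p = v & size p = dist e u v].
Proof.
case/connectP=> p0 up0 ->.
case: (shortenP up0) => q uq uniq_q _.
have q_lt : size (u :: q) <= #|T| by rewrite -(card_uniqP uniq_q) max_card.
have has_k : has (fun k => [exists p : k.-tuple T, graph_path e u (last u q) p])
                 (iota 0 #|T|).
  apply/hasP; exists (size q); first by rewrite mem_iota.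
  by apply/existsP; exists (in_tuple q); rewrite /graph_path uq eqxx uniq_q.
have := nth_find 0 has_k.
rewrite nth_iota; last by rewrite -[ltnRHS](size_iota 0) -has_find.
case/existsP=> p /and3P[up /eqP lp _].
by exists p; rewrite size_tuple.
Qed.

Lemma dist_triangle u v w : connect e u v -> connect e v w ->
  dist e u w <= dist e u v + dist e v w.
Proof.
case/geodesic_exists=> p [up lp <-] /geodesic_exists[q [vq lq <-]].
by rewrite -size_cat; apply: dist_le; rewrite ?cat_path ?last_cat lp ?up.
Qed.

Lemma path_rev u v p : symmetric e -> path e u p -> last u p = v ->
  exists q, [/\ path e v q, last v q = u, size q = size p & {subset q <= u :: p}].
Proof.
move=> esym up <-; exists (rev (belast u p)); split.
- by rewrite rev_path (eq_path (e' := e)) // => a b; rewrite esym.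
- by case: p {up} => //= w p; rewrite rev_cons last_rcons.
- by rewrite size_rev size_belast.
- by move=> w; rewrite mem_rev; apply: mem_belast.
Qed.

Lemma dist_sym u v : symmetric e -> connected_graph e -> dist e u v = dist e v u.
Proof.
move=> esym econn.
have le_d a b : dist e a b <= dist e b a.
  have [p [bp lp <-]] := geodesic_exists (econn b a).
  by have [q [aq lq <- _]] := path_rev esym bp lp; apply: dist_le.
by apply/eqP; rewrite eqn_leq !le_d.
Qed.

End Distance.

Section WeakConvexity.
Local Open Scope nat_scope.
Variables (T : finType) (e : rel T) (W : {set T}).
Implicit Types (u v : T) (p : seq T).

(** As [p] omits the start [u], membership of [u] in [W] has to come from elsewhere. *)
Definition geodesic_in u v p :=
  [/\ path e u p, last u p = v, {subset p <= W} & size p = dist e u v].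

Lemma path_induced (u : {x : T | x \in W}) p :
  path e (val u) p -> {subset p <= W} ->
  exists2 q, p = map val q & path (@induced T e W) u q.
Proof.
move=> up /allP/(all_sigP (a := mem W))[q def_p]; exists q => //.
by rewrite def_p path_map in up.
Qed.

(** Paths of the induced subgraph are, through [val], the paths of the graph inside [W], with the
    same lengths. This moves the argument out of the subtype. *)
Lemma weakly_convexP : connected_graph e ->
  weakly_convex e W <->
  {in W &, forall u v, exists p, geodesic_in u v p}.
Proof.
move=> econn; split=> [wcW u v Wu Wv | geoW u v].
  have [] := wcW (exist _ u Wu) (exist _ v Wv).
  case/geodesic_exists=> q [uq lq sz_q] /= def_d; exists (map val q); split.
  - by rewrite -[u]/(val (exist (fun z => z \in W) u Wu)) path_map.
  - by rewrite (last_map val q (exist _ u Wu)) lq.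
  - by move=> _ /mapP[x _ ->]; apply: valP.
  - by rewrite size_map sz_q.
have [p [up lp Wp sz_p]] := geoW _ _ (valP u) (valP v).
have [q def_p uq] := path_induced up Wp.
have lq : last u q = v by apply: val_inj; rewrite -lp def_p last_map.
have conn_uv : connect (@induced T e W) u v by apply/connectP; exists q.
split=> //; apply/eqP; rewrite eqn_leq -{1}sz_p def_p size_map dist_le //=.
case/geodesic_exists: conn_uv => r [ur lr <-]; rewrite -(size_map val).
by apply: dist_le; rewrite ?path_map // last_map lr.
Qed.

(* The (u, v) constraint of the program, for u and v in W. *)
Definition geodesic_step u v :=
  exists2 k, k \in W & e v k && (dist e u k + dist e k v == dist e u v).

Lemma weakly_convex_step u v : symmetric e -> connected_graph e ->
  weakly_convex e W -> u \in W -> v \in W -> u != v -> geodesic_step u v.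
Proof.
move=> esym econn /(weakly_convexP econn) geoW Wu Wv neq_uv.
have [p [up lp Wp sz_p]] := geoW u v Wu Wv.
case/lastP: p up lp Wp sz_p => [_ /= def_v | q w].
  by rewrite def_v eqxx in neq_uv.
rewrite rcons_path last_rcons size_rcons => /andP[uq ekw] def_w Wq sz_q; subst w.
(* The predecessor of [v] on the geodesic; it is [u] itself when [q] is empty. *)
exists (last u q).
  have := mem_last u q; rewrite inE => /predU1P[-> // | q_k].
  by rewrite Wq // mem_rcons inE q_k orbT.
(* One inequality is the triangle inequality; for the other, [q] bounds the distance to the
   predecessor and the last edge adds at most 1. *)
rewrite esym ekw /= eqn_leq dist_triangle // andbT -sz_q -addn1.
by apply: leq_add; [exact: dist_le uq _ | rewrite (dist_le (p := [:: v])) //= ekw].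
Qed.

Lemma geodesic_in_rev u v : symmetric e -> connected_graph e ->
  u \in W -> (exists p, geodesic_in u v p) -> exists q, geodesic_in v u q.
Proof.
move=> esym econn Wu [p [up lp Wp sz_p]].
have [q [vq lq sz_q sub_q]] := path_rev esym up lp.
exists q; split=> //; last by rewrite sz_q sz_p dist_sym.
by move=> w /sub_q; rewrite inE => /predU1P[-> | /Wp].
Qed.

Lemma geodesic_step_extend u v : symmetric e -> irreflexive e ->
    connected_graph e -> v \in W -> geodesic_step u v ->
    (forall k, k \in W -> dist e u k < dist e u v -> exists p, geodesic_in u k p) ->
  exists p, geodesic_in u v p.
Proof.
move=> esym eirr econn Wv [k Wk /andP[evk /eqP def_d]] geo.
have ekv : e k v by rewrite esym.
(* Having no loops excludes distance 0, so [k] is strictly closer to [u] than [v] is and [geo]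
   applies to it. *)
have dist_kv : dist e k v = 1.
  apply/eqP; rewrite eqn_leq (dist_le (p := [:: v])) /= ?ekv // lt0n.
  apply/eqP=> d0; have [[|w p] [_ def_v sz_p]] := geodesic_exists (econn k v).
    by rewrite -def_v /= eirr in ekv.
  by rewrite d0 in sz_p.
rewrite -def_d dist_kv addn1 in geo *.
have [p [up lp Wp sz_p]] := geo k Wk (leqnn _).
exists (rcons p v); split.
- by rewrite rcons_path up lp.
- by rewrite last_rcons.
- by move=> w; rewrite mem_rcons inE => /predU1P[-> | /Wp].
- by rewrite size_rcons sz_p -def_d dist_kv addn1.
Qed.

Lemma weakly_convex_of_steps : symmetric e -> irreflexive e ->
    connected_graph e ->
    {in W &, forall u v, u != v -> geodesic_step u v \/ geodesic_step v u} ->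
  weakly_convex e W.
Proof.
move=> esym eirr econn steps; apply/(weakly_convexP econn) => u v.
(* Both endpoints stay general in the induction, since a step from [v] to [u] fixes [v] and replaces
   [u]. *)
have [m] := ubnP (dist e u v); elim: m u v => // m IHm u v le_m Wu Wv.
have [<- | neq_uv] := eqVneq u v.
  exists [::]; split=> //.
  by apply/eqP; rewrite eq_sym -leqn0 (dist_le (p := [::])).
case: (steps u v Wu Wv neq_uv) => st.
  by apply: geodesic_step_extend st _ => // k Wk lt_k; apply: IHm => //; lia.
apply: geodesic_in_rev => //; apply: geodesic_step_extend st _ => // k Wk lt_k.
by apply: IHm => //; rewrite (dist_sym v u) // in lt_k; lia.
Qed.

End WeakConvexity.

Section Indicator.
Variables (n : nat) (e : rel 'I_n) (W : {set 'I_n}) (x : 'rV[int]_n).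
Hypothesis hx : forall i : 'I_n, x 0 i = if i \in W then 1 else 0.

Lemma sum_indicator (P : pred 'I_n) :
  \sum_(j | P j) x 0 j = #|[pred j | P j & j \in W]|%:Z.
Proof.
rewrite (eq_bigr _ (fun j _ => hx j)) -big_mkcondr /=.
by rewrite (sumr_const [pred j | P j & j \in W]) natz.
Qed.

Lemma sum_indicator_ge0 (P : pred 'I_n) : 0 <= \sum_(j | P j) x 0 j.
Proof. by rewrite sum_indicator. Qed.

Lemma sum_indicatorP (P : pred 'I_n) :
  reflect (exists2 j, j \in W & P j) (1 <= \sum_(j | P j) x 0 j).
Proof.
rewrite sum_indicator lez_nat; apply: (iffP card_gt0P) => [[j] | [j Wj Pj]].
  by rewrite inE => /andP[Pj Wj]; exists j.
by exists j; rewrite inE Pj.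
Qed.

Lemma objective_indicator : objective x = #|W|%:Z.
Proof. by rewrite /objective sum_indicator; congr Posz; apply: eq_card. Qed.

Lemma feasible_indicator :
  symmetric e -> irreflexive e -> connected_graph e ->
  feasible e x <-> weakly_convex_dominating e W.
Proof.
move=> esym eirr econn; split=> [[dom conv _] | [conv dom]]; split.
- apply: weakly_convex_of_steps => // u v Wu Wv neq_uv.
  (* The disjunction of the two orientations is symmetric in [u] and [v]. *)
  wlog lt_uv : u v Wu Wv neq_uv / (u < v)%N => [IH|].
    have [lt_uv | lt_vu | eq_uv] := ltngtP u v; first exact: IH.
      by rewrite or_comm; apply: IH; rewrite // eq_sym.
    by rewrite (val_inj eq_uv) eqxx in neq_uv.
  left; have := conv u v lt_uv; rewrite !hx Wu Wv => conv_uv.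
  (* With both endpoints in [W] the constraint reads -1 - 1 + sum >= -1. *)
  have /sum_indicatorP[k Wk] : 1 <= \sum_(k in neighbours e v
      | (dist e u k + dist e k v)%N == dist e u v) x 0 k by lia.
  by rewrite inE => ek; exists k.
- move=> u; have := dom u; rewrite hx.
  case: ifP => [|_]; [by left | rewrite add0r => /sum_indicatorP[v Wv]].
  by rewrite inE => euv; right; exists v.
- move=> u; rewrite hx.
  case: (dom u) => [-> | [v Wv euv]]; first by rewrite lerDl sum_indicator_ge0.
  apply: ler_wpDl; first by case: ifP.
  by apply/sum_indicatorP; exists v; rewrite ?inE.
- move=> u v lt_uv; rewrite !hx.
  set S := \sum_(k in _ | _) _; have S_ge0 : 0 <= S := sum_indicator_ge0 _.
  (* If an endpoint lies outside [W], then [S >= 0] already gives the bound; only the case of both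
     in [W] remains. *)
  case: ifP => Wu; case: ifP => Wv; try lia.
  have neq_uv : u != v by rewrite -val_eqE ltn_eqF.
  have [k Wk ek] := weakly_convex_step esym econn conv Wu Wv neq_uv.
  suff : 1 <= S by lia.
  by apply/sum_indicatorP; exists k; rewrite ?inE.
- by move=> u; rewrite hx; case: ifP; [right | left].
Qed.

End Indicator.

Theorem theorem3 (n : nat) (e : rel 'I_n)
    (esym : symmetric e) (eirr : irreflexive e) (econn : connected_graph e)
    (W : {set 'I_n}) (x : 'rV[int]_n)
    (hx : forall i : 'I_n, x 0 i = if i \in W then 1 else 0) :
  minimal_weakly_convex_dominating e W <-> optimal e x.
Proof.
have feasE U y hy := @feasible_indicator n e U y hy esym eirr econn.
split=> -[optW minW]; split; try exact/(feasE _ _ hx).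
- move=> y feas_y.
  (* Integrality makes every feasible competitor the indicator of its support, so it corresponds to
     a weakly convex dominating set. *)
  have hy i : y 0 i = if i \in [set j | y 0 j == 1] then 1 else 0.
    by rewrite inE; case: feas_y => _ _ /(_ i)[] ->.
  rewrite (objective_indicator hx) (objective_indicator hy) lez_nat.
  exact/minW/(feasE _ _ hy).
- move=> U wcdU; pose y : 'rV[int]_n := \row_i (if i \in U then 1 else 0).
  have hy i : y 0 i = if i \in U then 1 else 0 by rewrite mxE.
  rewrite -lez_nat -(objective_indicator hx) -(objective_indicator hy).
  exact/minW/(feasE _ _ hy).
Qed.
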